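(* Let $\mathbb{K}$ be a field of characteristic zero. Let $m,k\geq 1$ be integers and let $r$ be an integer with $r\geq k^2(m+1)$. Then there exists a nonempty Zariski open subset $U_{k,m,r}\subseteq\mathbb{K}[z]^0_{\leq r}$ such that, for every $\sigma\in U_{k,m,r}$ and every $k$-tuple of pairwise distinct polynomials $p_1,\ldots,p_k\in\mathbb{K}[t]^0$ of degree $m$, the polynomials $\sigma(p_1),\ldots,\sigma(p_k)$ are linearly independent over $\mathbb{K}$.
   Context: $\mathbb{K}[t]^0:=\{p\in\mathbb{K}[t] : p(0)=0\}$ is the space of origin-passing polynomials, and $\mathbb{K}[z]^0_{\leq r}$ is the $\mathbb{K}$-vector space of polynomials $\sigma\in\mathbb{K}[z]$ of degree at most $r$ with $\sigma(0)=0$, identified with the affine space $\mathbb{K}^{r}$ of coefficients with its Zariski topology. $\sigma(p)$ denotes the composition $\sigma(p(t))$. ''Of degree $m$'' means of degree exactly $m$. *)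

(* Defs.v *)
From mathcomp Require Import all_boot all_algebra.
From mathcomp Require Import mpoly.

Set Implicit Arguments.
Unset Strict Implicit.
Unset Printing Implicit Defensive.

Import GRing.Theory.
Local Open Scope ring_scope.

Section Zariski.
Variables (K : fieldType) (n : nat).

Definition zero_locus (S : {mpoly K[n]} -> Prop) : 'rV[K]_n -> Prop :=
  fun c => forall f, S f -> f.@[c ord0] = 0.

Definition zariski_closed (Z : 'rV[K]_n -> Prop) : Prop :=
  exists S : {mpoly K[n]} -> Prop, forall c, Z c <-> zero_locus S c.

Definition zariski_open (U : 'rV[K]_n -> Prop) : Prop :=
  zariski_closed (fun c => ~ U c).

End Zariski.

Section OriginPassing.
Variable K : fieldType.

Definition origin_passing (p : {poly K}) : Prop := p.[0] = 0.

(* [size p = degree p + 1] for p != 0, and [size 0 = 0]. *)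
Definition origin_passing_le (r : nat) (p : {poly K}) : Prop :=
  (size p <= r.+1)%N /\ origin_passing p.

Definition has_degree (m : nat) (p : {poly K}) : Prop := size p = m.+1.

(* The identification of K^r with the origin-passing polynomials of degree at
   most r: coordinate i is the coefficient of 'X^(i.+1). *)
Definition poly_of_row (r : nat) (c : 'rV[K]_r) : {poly K} :=
  \sum_(i < r) c ord0 i *: 'X^(i.+1).

Definition row_of_poly (r : nat) (p : {poly K}) : 'rV[K]_r :=
  \row_(i < r) p`_i.+1.

Lemma coef_poly_of_row r (c : 'rV[K]_r) (i : 'I_r) :
  (poly_of_row c)`_i.+1 = c ord0 i.
Proof.
rewrite /poly_of_row coef_sum (bigD1 i) //= coefZ coefXn eqxx mulr1.
rewrite big1 ?addr0 // => j ji; rewrite coefZ coefXn eqSS.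
by rewrite eq_sym (inj_eq val_inj) (negbTE ji) mulr0.
Qed.

Lemma poly_of_rowK r : cancel (@poly_of_row r) (row_of_poly r).
Proof.
by move=> c; apply/rowP => i; rewrite mxE coef_poly_of_row.
Qed.

Lemma poly_of_rowP r (c : 'rV[K]_r) : origin_passing_le r (poly_of_row c).
Proof.
split.
  apply: (leq_trans (size_sum _ _ _)); apply/bigmax_leqP => i _.
  by apply: (leq_trans (size_scale_leq _ _)); rewrite size_polyXn ltnS.
rewrite /origin_passing horner_sum big1 // => i _.
by rewrite hornerZ hornerXn expr0n mulr0.
Qed.

Lemma row_of_polyK r (p : {poly K}) :
  origin_passing_le r p -> poly_of_row (row_of_poly r p) = p.
Proof.
case=> szp p0; apply/polyP => -[|j].
  by rewrite -!horner_coef0 p0; case: (poly_of_rowP (row_of_poly r p)).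
have [jr|rj] := ltnP j r.
  by rewrite (coef_poly_of_row _ (Ordinal jr)) mxE.
rewrite !nth_default //; first exact: leq_trans szp _.
by case: (poly_of_rowP (row_of_poly r p)) => + _ => /leq_trans; apply.
Qed.

Definition zariski_open_polys (r : nat) (U : {poly K} -> Prop) : Prop :=
  (forall s, U s -> origin_passing_le r s) /\
  zariski_open (fun c : 'rV[K]_r => U (poly_of_row c)).

(* [free] of the vector library needs a finite-dimensional ambient space. *)
Definition lin_indep (k : nat) (q : 'I_k -> {poly K}) : Prop :=
  forall a : 'I_k -> K, \sum_(i < k) a i *: q i = 0 -> forall i, a i = 0.

End OriginPassing.

(* Main.v *)
Require Import Defs.
From mathcomp Require Import all_boot all_algebra.
From mathcomp Require Import mpoly.
From mathcomp Require Import zify.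

Set Implicit Arguments.
Unset Strict Implicit.
Unset Printing Implicit Defensive.

Import GRing.Theory.
Local Open Scope ring_scope.

(** Why the theorem holds.  Let [s = \sum_j c_j X^j], with [j] from [1] to [r].
    A dependence [\sum_i a_i s(p_i) = 0] is a linear condition on [c], namely
    [\sum_j c_j s_j = 0], where [s_j := \sum_i a_i p_i^j].  The proof is a
    dimension count in the space of all triples (a, p, c) that satisfy it.

    Many independent conditions.  For fixed [a != 0] and distinct [p_i] of degree
    [m], at least [k * (m + 1)] of the polynomials [s_1, ..., s_r] have pairwise
    distinct degrees, so the conditions on [c] have at least that rank.  Indeed
    [s_j] satisfies the linear recurrence with characteristic polynomial
    [\prod_i (X - p_i)], whose coefficients have controlled degree and whose
    constant term has degree exactly [m * k].  Put [defect(s_j) := m * j - deg s_j].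
    Running the recurrence forwards and backwards shows that the least defect [e]
    in a block of [k] consecutive indices is the same for all blocks.  So every
    block contains an [s_j] of degree exactly [m * j - e]
    ([power_sum_size_in_block]), and there are [k * (m + 1)] disjoint blocks
    because [k^2 * (m + 1) <= r].

    Few parameters.  One nonzero [a_i] can be scaled to [1], which leaves
    [(k - 1) + k * m < k * (m + 1)] parameters: the other scalars and the
    coefficients of the [p_i].

    Elimination.  Let a linear system on [c] have coefficients polynomial in [n]
    parameters and a nonzero minor of size [d > n].  By Cramer's rule [c] is
    determined rationally by the parameters and by [r - d] of its coordinates, fewer
    than [r] quantities altogether.  A counting argument shows that the image of
    such a rational map lies in a hypersurface ([image_in_hypersurface]), so all
    the solutions do ([kernels_in_hypersurface]).  The complement of the
    hypersurface is the required open set; it has a rational point because [K],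
    of characteristic zero, is infinite ([meval_neq0_exists]). *)

(** * Rational points outside a hypersurface *)

Lemma digits_inj (N n : nat) (x y : 'I_n -> nat) :
  (forall i, x i < N)%N -> (forall i, y i < N)%N ->
  (\sum_i x i * N ^ i = \sum_i y i * N ^ i)%N -> x =1 y.
Proof.
elim: n x y => [|n IHn] x y ltx lty; first by move=> _ [].
have N_gt0 : (0 < N)%N by apply: leq_ltn_trans (ltx ord0).
have split_low (z : 'I_n.+1 -> nat) :
    (\sum_i z i * N ^ i = (\sum_(i < n) z (lift ord0 i) * N ^ i) * N + z ord0)%N.
  rewrite big_ord_recl expn0 muln1 addnC big_distrl /=; congr (_ + _)%N.
  by apply: eq_bigr => i _; rewrite /bump /= add1n expnSr mulnA.
rewrite !split_low => eq_xy.
have eq0 : x ord0 = y ord0.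
  by have /(congr1 (modn^~ N)) := eq_xy; rewrite /= !modnMDl !modn_small.
have/eqP := eq_xy; rewrite eq0 eqn_add2r eqn_pmul2r // => /eqP/IHn eqS.
move=> i; case: (unliftP ord0 i) => [j ->|-> //].
by apply: eqS => // l.
Qed.

Lemma nonroot_exists (K : fieldType) (charK0 : [pchar K] =i pred0)
    (P : {poly K}) : P != 0 -> exists x, P.[x] != 0.
Proof.
move=> P_neq0; pose rs : seq K := [seq i%:R | i <- iota 0 (size P)].
have rs_uniq : uniq rs.
  rewrite map_inj_uniq ?iota_uniq // => i j /eqP.
  wlog le_ij : i j / (i <= j)%N.
    by move=> IH; case/orP: (leq_total i j) => /IH // + /[1!eq_sym] eqij => /(_ eqij).
  rewrite eq_sym -subr_eq0 -natrB // (pcharf0P _).1 // subn_eq0 => le_ji.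
  by apply/eqP; rewrite eqn_leq le_ij.
have [all_roots|] := boolP (all (root P) rs).
  by have := max_poly_roots P_neq0 all_roots rs_uniq; rewrite size_map size_iota ltnn.
by case/allPn => x _ x_nonroot; exists x.
Qed.

(** Kronecker's substitution [x_i := x ^ (N ^ i)], with [N] larger than all the
    exponents in [f], sends distinct monomials of [f] to distinct powers of [x];
    hence the problem reduces to one variable. *)
Lemma meval_neq0_exists (K : fieldType) (charK0 : [pchar K] =i pred0)
    (n : nat) (f : {mpoly K[n]}) :
  f != 0 -> exists v : 'I_n -> K, f.@[v] != 0.
Proof.
move=> f_neq0; pose N := msize f.
pose kron (m : 'X_{1..n}) := (\sum_i m i * N ^ i)%N.
have kron_inj : {in msupp f &, injective kron}.
  move=> m1 m2 /msize_mdeg_lt lt1 /msize_mdeg_lt lt2 eq_kron.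
  have digit_lt (m : 'X_{1..n}) i : (mdeg m < N)%N -> (m i < N)%N.
    by apply: leq_ltn_trans; rewrite mdegE (bigD1 i) //= leq_addr.
  by apply/mnmP; apply: (@digits_inj N) eq_kron => i; apply: digit_lt.
pose P : {poly K} := \sum_(m <- msupp f) f@_m *: 'X^(kron m).
have P_neq0 : P != 0.
  have lead_in := mlead_supp f_neq0.
  apply/eqP => /(congr1 (fun p : {poly K} => p`_(kron (mlead f)))).
  rewrite coef0 coef_sum (bigD1_seq (mlead f)) ?msupp_uniq //= big_seq_cond big1.
    by apply/eqP; rewrite addr0 coefZ coefXn eqxx mulr1 mleadc_eq0.
  move=> m /andP[m_in m_neq]; rewrite coefZ coefXn (inj_in_eq kron_inj) //.
  by rewrite eq_sym (negbTE m_neq) mulr0.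
have [x Px] := nonroot_exists charK0 P_neq0.
exists (fun i => x ^+ (N ^ i)); rewrite mevalE.
rewrite (_ : \sum_(m <- _) _ = P.[x]) // horner_sum; apply: eq_bigr => m _.
rewrite hornerZ hornerXn -prodrXr; congr (_ * _); apply: eq_bigr => i _.
by rewrite -exprM mulnC.
Qed.

(** * Polynomial images of small dimension lie in hypersurfaces *)

Lemma linear_relation (K : fieldType) (A B : finType) (c : A -> B -> K) :
  (#|B| < #|A|)%N ->
  exists2 v : A -> K, (exists a, v a != 0)
    & forall b, \sum_a v a * c a b = 0.
Proof.
move=> ltBA.
pose M : 'M[K]_(#|A|, #|B|) := \matrix_(i, j) c (enum_val i) (enum_val j).
have : kermx M != 0.
  rewrite kermx_eq0; apply: contraL ltBA => /eqP <-.
  by rewrite -leqNgt rank_leq_col.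
case/rowV0Pn => v /sub_kermxP vM0 v_neq0.
exists (fun a => v 0 (enum_rank a)).
  case/rV0Pn: v_neq0 => i vi; by exists (enum_val i); rewrite enum_valK.
move=> b; have /rowP/(_ (enum_rank b)) := vM0; rewrite !mxE => vM0b.
rewrite -[RHS]vM0b [RHS](reindex (@enum_rank A)) /=; last exact/onW_bij/enum_rank_bij.
by apply: eq_bigr => a _; rewrite mxE !enum_rankK.
Qed.

Lemma card_bmultinom_le (n d : nat) : (#|{: 'X_{1..n < d.+1}}| <= d.+1 ^ n)%N.
Proof.
pose digits (m : 'X_{1..n < d.+1}) := [ffun i : 'I_n => inord (m i) : 'I_d.+1].
have <- : #|{ffun 'I_n -> 'I_d.+1}| = (d.+1 ^ n)%N by rewrite card_ffun !card_ord.
apply: (@leq_card _ _ digits) => m1 m2 /ffunP eq12; apply/val_inj/mnmP => i.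
have /(congr1 val) := eq12 i; rewrite !ffunE /= !inordK //.
  by apply: leq_ltn_trans (bmdeg m2); rewrite mdegE (bigD1 i) //= leq_addr.
by apply: leq_ltn_trans (bmdeg m1); rewrite mdegE (bigD1 i) //= leq_addr.
Qed.

Section Degree.
Variables (K : fieldType) (n : nat).
Implicit Types (p : {mpoly K[n]}) (a : nat).

Lemma msizeM_leS p q a b :
  (msize p <= a.+1 -> msize q <= b.+1 -> msize (p * q) <= (a + b).+1)%N.
Proof.
have [->|p_neq0] := eqVneq p 0; first by rewrite mul0r msize0.
have [->|q_neq0] := eqVneq q 0; first by rewrite mulr0 msize0.
move=> lepa leqb; rewrite msizeM //.
by have := leq_add lepa leqb; rewrite addnS addSn -subn1 leq_subLR add1n.
Qed.

Lemma msizeX_leS p a e : (msize p <= a.+1 -> msize (p ^+ e) <= (e * a).+1)%N.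
Proof.
move=> le_pa; elim: e => [|e IHe]; first by rewrite expr0 msize1.
by rewrite exprS mulSn; apply: msizeM_leS.
Qed.

Lemma msize_prod_leS (I : finType) (p : I -> {mpoly K[n]}) (a : I -> nat) :
  (forall i, msize (p i) <= (a i).+1)%N ->
  (msize (\prod_i p i) <= (\sum_i a i).+1)%N.
Proof.
move=> le_pa; elim/big_rec2: _ => [|i b q _]; first by rewrite msize1.
exact: msizeM_leS.
Qed.

End Degree.

(** The [r] fractions [F_j / G] in [n < r] variables are algebraically dependent.
    The products of their powers with exponents at most [D], cleared of
    denominators by [G ^+ (r * D)], number [(D + 1) ^ r], but live in the space of
    polynomials of degree at most [r * D * E], where [E] bounds the degrees of [G]
    and the [F_j]; its dimension is [O(D ^ n)].  For large [D] there is a linear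
    relation, whose coefficients are those of [f]. *)
Lemma image_in_hypersurface (K : fieldType) (n r : nat)
    (F : 'I_r -> {mpoly K[n]}) (G : {mpoly K[n]}) :
  (n < r)%N ->
  exists2 f : {mpoly K[r]}, f != 0
    & forall (y : 'I_n -> K) (c : 'I_r -> K), G.@[y] != 0 ->
        (forall j, G.@[y] * c j = (F j).@[y]) -> f.@[c] = 0.
Proof.
move=> lt_nr.
pose E := maxn (msize G) (\max_j msize (F j)).
(* This [D] suffices: [r * D * E + 1 <= (r * E + 1) * (D + 1)], so at most
   [D * (D + 1) ^ n < (D + 1) ^ r] monomials occur. *)
pose D := ((r * E).+1 ^ n)%N.
pose A := {ffun 'I_r -> 'I_D.+1}.
pose wt (al : A) := (\sum_j al j)%N.
have wt_le al : (wt al <= r * D)%N.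
  rewrite -[X in (X * D)%N]card_ord -sum_nat_const; apply: leq_sum => j _.
  by rewrite -ltnS.
pose H (al : A) := (\prod_j F j ^+ al j) * G ^+ (r * D - wt al).
have H_size al : (msize (H al) <= (r * D * E).+1)%N.
  have -> : (r * D * E = \sum_j al j * E + (r * D - wt al) * E)%N.
    by rewrite -big_distrl -mulnDl /= subnKC //; apply: wt_le.
  apply: msizeM_leS.
    apply: msize_prod_leS => j; apply: msizeX_leS; apply: leqW.
    by rewrite leq_max orbC (bigmax_sup j).
  by apply: msizeX_leS; rewrite leqW // leq_maxl.
have [] := @linear_relation K A 'X_{1..n < (r * D * E).+1} (fun al m => (H al)@_m).
  apply: leq_ltn_trans (card_bmultinom_le _ _) _.
  rewrite card_ffun !card_ord.
  apply: (@leq_ltn_trans ((r * E).+1 ^ n * D.+1 ^ n)).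
    rewrite -expnMn; case: (n) => [|n'] //; rewrite leq_exp2r //.
    by rewrite mulSn mulnS addSn ltnS mulnAC addnA leq_addl.
  apply: (@leq_trans (D.+1 ^ n.+1)); first by rewrite expnS ltn_mul2r expn_gt0 ltnSn.
  by rewrite leq_pexp2l.
move=> v [al0 v_al0] rel.
have sumH : \sum_al v al *: H al = 0.
  apply/mpolyP => m; rewrite mcoeff0 raddf_sum /=.
  have [lt_m|ge_m] := ltnP (mdeg m) (r * D * E).+1.
    by rewrite -[RHS](rel (BMultinom lt_m)); apply: eq_bigr => al _; rewrite mcoeffZ.
  rewrite big1 // => al _; rewrite mcoeffZ memN_msupp_eq0 ?mulr0 //.
  by apply: contraL ge_m => /msize_mdeg_lt /leq_trans; rewrite -ltnNge; apply.
pose mon (al : A) : 'X_{1..r} := [multinom (al j : nat) | j < r].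
have mon_inj : injective mon.
  move=> al be /mnmP eq_mon; apply/ffunP => j.
  by apply/val_inj; have := eq_mon j; rewrite !mnmE.
exists (\sum_al v al *: 'X_[mon al]).
  apply: contraNneq v_al0 => /(congr1 (mcoeff (mon al0))).
  rewrite mcoeff0 raddf_sum (bigD1 al0) //= mcoeffZ mcoeffX eqxx mulr1.
  rewrite big1 ?addr0 => [->//|al al_neq].
  by rewrite mcoeffZ mcoeffX (inj_eq mon_inj) (negbTE al_neq) mulr0.
move=> y c Gy_neq0 cF.
apply: (@mulfI _ (G.@[y] ^+ (r * D))); first by rewrite expf_neq0.
rewrite mulr0 -[RHS](meval0 y) -sumH !raddf_sum mulr_sumr; apply: eq_bigr => al _ /=.
rewrite !mevalZ mevalX mevalM rmorph_prod rmorphXn /= mulrCA; congr (_ * _).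
rewrite -(subnK (wt_le al)) exprD -mulrA mulrC addnK; congr (_ * _).
rewrite /wt -prodrXr -big_split; apply: eq_bigr => j _ /=.
by rewrite mnmE -exprMn cF rmorphXn.
Qed.

(** * Elimination of the parameters of a linear system *)

(** The identity [P P' + Q Q' = 1] writes every [c] as [P u + Q v] with
    [u := P' c] and [v := Q' c].  When [det (M P)] is nonzero, the equation
    [M P u = - M Q v] and Cramer's rule make [det (M P) c] a polynomial in the [n]
    parameters and the [q] coordinates of [v]: fewer than [r] variables. *)
Lemma split_kernels_in_hypersurface (K : fieldType) (n d q r : nat)
    (M : 'M[{mpoly K[n]}]_(d, r))
    (P : 'M[K]_(r, d)) (P' : 'M[K]_(d, r)) (Q : 'M[K]_(r, q)) (Q' : 'M[K]_(q, r)) :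
  P *m P' + Q *m Q' = 1%:M -> (n + q < r)%N ->
  exists2 f : {mpoly K[r]}, f != 0
    & forall (y : 'I_n -> K) (c : 'cV[K]_r),
        \det (map_mx (meval y) M *m P) != 0 -> map_mx (meval y) M *m c = 0 ->
        f.@[fun j => c j 0] = 0.
Proof.
move=> PQ1 lt_nqr.
pose tX := [tuple ('X_(lshift q i) : {mpoly K[n + q]}) | i < n].
pose ML := map_mx (comp_mpoly tX) M.
pose C m1 m2 (A : 'M[K]_(m1, m2)) := map_mx (@mpolyC (n + q) K) A.
pose v : 'cV[{mpoly K[n + q]}]_q := \col_i 'X_(rshift n i).
pose G := \det (ML *m C _ _ P).
pose F := C _ _ P *m (- (\adj (ML *m C _ _ P) *m (ML *m C _ _ Q *m v)))
          + G *: (C _ _ Q *m v).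
have [f f_neq0 fP] := image_in_hypersurface (fun j => F j 0) G lt_nqr.
exists f => // y c det_neq0 Mc0.
pose z (i : 'I_(n + q)) :=
  match split i with inl i => y i | inr i => (Q' *m c) i 0 end.
have evML : map_mx (meval z) ML = map_mx (meval y) M.
  apply/matrixP => i j; rewrite !mxE comp_mpoly_meval; apply: meval_eq => l.
  by rewrite tnth_mktuple mevalXU /z (unsplitK (inl _)).
have evC m1 m2 (A : 'M[K]_(m1, m2)) : map_mx (meval z) (C _ _ A) = A.
  by apply/matrixP => i j; rewrite !mxE mevalC.
have evv : map_mx (meval z) v = Q' *m c.
  by apply/colP => i; rewrite mxE mxE mevalXU /z (unsplitK (inr _)).
have evG : G.@[z] = \det (map_mx (meval y) M *m P).
  by rewrite -det_map_mx map_mxM evML evC.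
have evF : map_mx (meval z) F = G.@[z] *: c.
  rewrite map_mxD map_mxM map_mxN map_mxM map_mx_adj !map_mxM map_mxZ map_mxM.
  rewrite !evC evv evML.
  set N := map_mx (meval y) M in evG Mc0 *.
  have -> : N *m Q *m (Q' *m c) = - (N *m P *m (P' *m c)).
    apply/eqP; rewrite -subr_eq0 opprK -!mulmxA -mulmxDr !mulmxA -mulmxDl.
    by rewrite addrC PQ1 mul1mx Mc0.
  rewrite mulmxN opprK (mulmxA (\adj _)) mul_adj_mx -evG mul_scalar_mx.
  by rewrite -scalemxAr -scalerDr !mulmxA -mulmxDl PQ1 mul1mx.
apply: (fP z); first by rewrite evG.
by move=> j; have /colP/(_ j) := evF; rewrite !mxE => <-.
Qed.

Lemma selection_complement (R : pzRingType) (d r : nat) (J : 'I_d -> 'I_r) :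
  injective J ->
  exists q, exists g : 'I_q -> 'I_r,
    (d + q)%N = r /\
    colsub J 1%:M *m rowsub J 1%:M + colsub g 1%:M *m rowsub g 1%:M = 1%:M :> 'M[R]_r.
Proof.
move=> J_inj; pose S := [set j in codom J].
have S_im : S = [set J b | b in 'I_d].
  by apply/setP => j; rewrite inE; apply/codomP/imsetP => [[b ->]|[b _ ->]]; exists b.
exists #|~: S|, (fun i => enum_val i); split.
  by rewrite -[in LHS](card_ord d) -(card_imset _ J_inj) -S_im cardsC card_ord.
rewrite -[RHS]mulmx1; apply/matrixP => i j; rewrite !mxE.
rewrite [RHS](bigID (mem S)) /=; congr (_ + _).
  rewrite S_im big_imset /=; last by move=> ? ? _ _; apply: J_inj.
  by apply: eq_bigr => b _; rewrite !mxE.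
rewrite (eq_bigl (mem (~: S))); last by move=> l; rewrite !inE.
by rewrite [RHS]big_enum_val; apply: eq_bigr => b _; rewrite !mxE.
Qed.

(** [f] is the product, over all positions [(I, J)] of a minor, of the equations
    that [split_kernels_in_hypersurface] gives on the locus where that minor is
    nonzero. *)
Lemma kernels_in_hypersurface (K : fieldType) (n d e r : nat)
    (M : 'M[{mpoly K[n]}]_(e, r)) :
  (n < d)%N ->
  exists2 f : {mpoly K[r]}, f != 0
    & forall (y : 'I_n -> K) (c : 'cV[K]_r) (I : 'I_d -> 'I_e) (J : 'I_d -> 'I_r),
        \det (mxsub I J (map_mx (meval y) M)) != 0 ->
        map_mx (meval y) M *m c = 0 ->
        f.@[fun j => c j 0] = 0.
Proof.
move=> lt_nd.
have hyp (IJ : {ffun 'I_d -> 'I_e} * {ffun 'I_d -> 'I_r}) :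
    exists2 f : {mpoly K[r]}, f != 0 & forall (y : 'I_n -> K) (c : 'cV[K]_r),
      \det (mxsub IJ.1 IJ.2 (map_mx (meval y) M)) != 0 ->
      map_mx (meval y) M *m c = 0 -> f.@[fun j => c j 0] = 0.
  case: IJ => I J /=.
  have [/injectiveP J_inj|/injectivePn[b [b' bb' Jbb']]] := boolP (injectiveb J).
    have [q [g [dq split1]]] := selection_complement K J_inj.
    have [|f f_neq0 fP] :=
      @split_kernels_in_hypersurface K n d q r (rowsub I M) _ _ _ _ split1.
      by rewrite -dq ltn_add2r.
    exists f => // y c det_neq0 Mc0; apply: (fP y); rewrite map_mxsub.
      by rewrite mulmx_colsub mulmx1 -mxsub_comp.
    by rewrite mul_rowsub_mx Mc0 mxsub_const.
  (* A repeated column makes the minor vanish identically. *)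
  exists 1 => [|y c]; first exact: oner_neq0.
  rewrite -det_tr (determinant_alternate bb') ?eqxx // => i.
  by rewrite !mxE Jbb'.
have [f f_neq0 fP] := fin_all_exists2 hyp.
exists (\prod_IJ f IJ); first exact/prodf_neq0.
move=> y c I J; pose IJ := ([ffun b => I b], [ffun b => J b]).
have -> : mxsub I J (map_mx (meval y) M) = mxsub IJ.1 IJ.2 (map_mx (meval y) M).
  by apply/matrixP => b b'; rewrite !mxE !ffunE.
move=> det_neq0 Mc0; rewrite (bigD1 IJ) //= mevalM.
by rewrite (fP IJ y c) ?mul0r.
Qed.

(** * Degree defects *)

Section Defect.
Variables (K : fieldType) (m : nat).
Implicit Types f g : {poly K}.

(** For [f != 0] this says [deg f <= m * j - e].  It is additive in [e] because
    the subtraction of natural numbers is truncated; the zero polynomial counts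
    as having infinite defect. *)
Definition defect_ge (e j : nat) f := (f == 0) || (size f + e <= (m * j).+1)%N.

Lemma defect_ge0 e j : defect_ge e j 0.
Proof. by rewrite /defect_ge eqxx. Qed.

Lemma defect_geD e j f g :
  defect_ge e j f -> defect_ge e j g -> defect_ge e j (f + g).
Proof.
rewrite /defect_ge; have [->|f0] := eqVneq f 0; first by rewrite add0r.
have [->|g0] := eqVneq g 0; first by rewrite addr0 (negbTE f0).
move=> /= lef leg; apply/orP; right.
apply: leq_trans (leq_add (size_polyD f g) (leqnn e)) _.
by rewrite addn_maxl geq_max lef.
Qed.

Lemma defect_geN e j f : defect_ge e j (- f) = defect_ge e j f.
Proof. by rewrite /defect_ge oppr_eq0 size_polyN. Qed.

Lemma defect_ge_sum e j (I : finType) (F : I -> {poly K}) :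
  (forall i, defect_ge e j (F i)) -> defect_ge e j (\sum_i F i).
Proof.
move=> F_ge; elim/big_ind: _ => // [|f g]; [exact: defect_ge0|exact: defect_geD].
Qed.

Lemma defect_geM e i j f g :
  defect_ge 0 i g -> defect_ge e j f -> defect_ge e (i + j) (g * f).
Proof.
rewrite /defect_ge mulf_eq0; case: eqVneq => //= g0; case: eqVneq => //= f0.
have -> : size (g * f) = (size g + size f).-1 by exact: size_mul.
rewrite mulnDr => leg lef.
have : (0 < size f)%N by rewrite size_poly_gt0 f0.
have : (0 < size g)%N by rewrite size_poly_gt0 g0.
by move: leg; move: (size g) (size f) lef => *; lia.
Qed.

Lemma defect_ge_cancel e i j f g :
  size g = (m * i).+1 -> defect_ge e (i + j) (g * f) -> defect_ge e j f.
Proof.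
move=> szg; have g0 : g != 0 by rewrite -size_poly_gt0 szg.
rewrite /defect_ge mulf_eq0 (negbTE g0); case: eqVneq => //= f0.
have -> : size (g * f) = (size g + size f).-1 by exact: size_mul.
rewrite szg mulnDr.
have : (0 < size f)%N by rewrite size_poly_gt0 f0.
by move: (size f) => *; lia.
Qed.

(** The coefficient of ['X^l] is, up to sign, the elementary symmetric polynomial
    of degree [size s - l] in the entries of [s], which have degree at most
    [m]. *)
Lemma defect_ge_coef_prod_XsubC (s : seq {poly K}) l h :
  {in s, forall x : {poly K}, size x <= m.+1}%N -> (l + h)%N = size s ->
  defect_ge 0 h (\prod_(x <- s) ('X - x%:P))`_l.
Proof.
elim: s l h => [|x s IHs] l h sz_s eq_lh.
  rewrite big_nil; case: l h eq_lh => [|l] [|h] //= _.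
  by rewrite coef1 /defect_ge size_poly1 muln0 orbT.
have sz_s' : {in s, forall x : {poly K}, size x <= m.+1}%N.
  by move=> z zs; apply: sz_s; rewrite inE zs orbT.
rewrite big_cons mulrBl coefB coefXM coefCM; apply: defect_geD.
  case: l eq_lh => [|l] /= eq_lh; first exact: defect_ge0.
  by apply: IHs => //; move: eq_lh; rewrite /=; lia.
rewrite defect_geN; case: h eq_lh => [|h] /= eq_lh.
  rewrite [X in _ * X]nth_default ?mulr0 ?defect_ge0 //.
  by rewrite size_prod_XsubC; lia.
rewrite -add1n; apply: defect_geM; last by apply: IHs => //; lia.
by rewrite /defect_ge muln1 addn0 sz_s ?orbT // mem_head.
Qed.

End Defect.

(** * Degrees of the weighted power sums *)

Section PowerSums.
Variables (K : fieldType) (m k : nat) (a : 'I_k -> K) (p : 'I_k -> {poly K}).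

Definition power_sum (j : nat) : {poly K} := \sum_i a i *: p i ^+ j.

(** Applying to the sequence of power sums the polynomial [L] in the shift operator
    multiplies the [i]-th summand by [L(p_i)].  The choice of [L] gives both the
    recurrence and, with a Lagrange polynomial, the isolation of one summand. *)
Lemma power_sum_horner (L : {poly {poly K}}) (n j : nat) :
  (size L <= n)%N ->
  \sum_(l < n) L`_l * power_sum (j + l) = \sum_i a i *: (p i ^+ j * L.[p i]).
Proof.
move=> szL; under eq_bigr do rewrite mulr_sumr.
rewrite exchange_big /=; apply: eq_bigr => i _.
rewrite (horner_coef_wide _ szL) mulr_sumr scaler_sumr; apply: eq_bigr => l _.
by rewrite -scalerAr exprD mulrCA.
Qed.

Lemma power_sum_neq0 :
  injective p -> (exists i, a i != 0) -> exists l : 'I_k, power_sum l != 0.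
Proof.
move=> p_inj [i0 ai0]; apply/existsP; apply: contraT.
rewrite negb_exists => /forallP s0.
pose L : {poly {poly K}} := \prod_(i <- enum (predC1 i0)) ('X - (p i)%:P).
have szL : (size L <= k)%N.
  rewrite size_prod_XsubC -cardE cardC1 card_ord prednK //.
  exact: leq_trans (ltn_ord i0).
have := power_sum_horner 0 szL.
rewrite big1 => [|l _]; last by rewrite add0n (eqP (negPn (s0 l))) mulr0.
rewrite (bigD1 i0) //= big1 => [|i ii0].
  move/esym/eqP; rewrite addr0 expr0 mul1r scaler_eq0 (negbTE ai0) /= horner_prod.
  rewrite prodf_seq_eq0 => /hasP[i]; rewrite mem_enum inE => ii0 /=.
  by rewrite !hornerE subr_eq0 (inj_eq p_inj) eq_sym (negbTE ii0).
suff /eqP-> : L.[p i] == 0 by rewrite mulr0 scaler0.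
rewrite horner_prod prodf_seq_eq0; apply/hasP; exists i; first by rewrite mem_enum.
by rewrite /= !hornerE subrr.
Qed.

Hypotheses (p_inj : injective p) (p_deg : forall i, size (p i) = m.+1).

Let recurrence_poly : {poly {poly K}} := \prod_i ('X - (p i)%:P).

Let size_recurrence_poly : size recurrence_poly = k.+1.
Proof.
by rewrite /recurrence_poly size_prod_XsubC /index_enum -enumT size_enum_ord.
Qed.

Lemma power_sum_recurrence (j : nat) :
  \sum_(l < k.+1) recurrence_poly`_l * power_sum (j + l) = 0.
Proof.
rewrite power_sum_horner ?size_recurrence_poly // big1 // => i _.
by rewrite horner_prod (bigD1 i) //= hornerXsubC subrr mul0r mulr0 scaler0.
Qed.

Let recurrence_poly_defect l h : (l + h)%N = k -> defect_ge m 0 h recurrence_poly`_l.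
Proof.
move=> lh; rewrite /recurrence_poly -(big_map p xpredT (fun x => 'X - x%:P)).
apply: defect_ge_coef_prod_XsubC; first by move=> x /mapP[i _ ->]; rewrite p_deg.
by rewrite size_map lh /index_enum -enumT size_enum_ord.
Qed.

Let size_recurrence_poly0 : size recurrence_poly`_0 = (m * k).+1.
Proof.
rewrite -horner_coef0 horner_prod size_prod => [|i _]; last first.
  by rewrite !hornerE oppr_eq0 -size_poly_gt0 p_deg.
under eq_bigr do rewrite !hornerE size_polyN p_deg.
by rewrite sum_nat_const cardT /= size_enum_ord; lia.
Qed.

Definition block_defect_ge (e j : nat) : bool :=
  [forall l : 'I_k, defect_ge m e (j + l) (power_sum (j + l))].

(** The recurrence expresses either end of a window of [k + 1] consecutive power
    sums by the others.  The top coefficient is [1]; going backwards one divides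
    by the constant coefficient, and this preserves the defect because that
    coefficient has the largest degree its weight allows, [m * k]. *)
Lemma block_defect_ge_shift e j :
  block_defect_ge e j.+1 = block_defect_ge e j.
Proof.
apply/forallP/forallP => dj l.
  have [l0|l_gt0] := posnP l; last first.
    have ltl : (l.-1 < k)%N by have := ltn_ord l; lia.
    by have := dj (Ordinal ltl); rewrite addSnnS /= prednK.
  rewrite l0 addn0; apply: (defect_ge_cancel size_recurrence_poly0).
  have := power_sum_recurrence j; rewrite big_ord_recl addn0.
  move/eqP; rewrite addr_eq0 => /eqP ->; rewrite defect_geN.
  apply: defect_ge_sum => b; rewrite lift0.
  have -> : (k + j = (k - b.+1) + (j + b.+1))%N by have := ltn_ord b; lia.
  apply: defect_geM; first by apply: recurrence_poly_defect; have := ltn_ord b; lia.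
  by have := dj b; rewrite addSnnS.
have [ltl|gel] := ltnP l.+1 k; first by have := dj (Ordinal ltl); rewrite addSnnS.
have lk : l.+1 = k by have := ltn_ord l; lia.
rewrite addSnnS lk.
have := power_sum_recurrence j; rewrite big_ord_recr /= addrC.
have /monicP : recurrence_poly \is monic by apply: monic_prod_XsubC.
rewrite lead_coefE size_recurrence_poly /= => ->; rewrite mul1r.
move/eqP; rewrite addr_eq0 => /eqP ->; rewrite defect_geN.
apply: defect_ge_sum => b.
have -> : (j + k = (k - b) + (j + b))%N by have := ltn_ord b; lia.
by apply: defect_geM; first by apply: recurrence_poly_defect; have := ltn_ord b; lia.
Qed.

(** [e] is the least defect in the first block, hence in every block. *)
Lemma power_sum_size_in_block :
  (exists i, a i != 0) ->
  exists e, forall j, exists l : 'I_k,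
    power_sum (j + l) != 0 /\ (size (power_sum (j + l)) + e = (m * (j + l)).+1)%N.
Proof.
move=> a_neq0; have [l0 s_l0] := power_sum_neq0 p_inj a_neq0.
have shift e j : block_defect_ge e j = block_defect_ge e 0.
  by elim: j => // j <-; rewrite block_defect_ge_shift.
have ex_e : exists e, ~~ block_defect_ge e.+1 0.
  exists (m * l0)%N; apply/negP => /forallP/(_ l0).
  rewrite add0n /defect_ge (negbTE s_l0) /=.
  have : (0 < size (power_sum l0))%N by rewrite size_poly_gt0.
  by move: (size _) (m * l0)%N => *; lia.
have [e e_ndef e_min] := ex_minnP ex_e; exists e => j.
have : block_defect_ge e j.
  rewrite shift; case: e e_min {e_ndef} => [_|e e_min]; last first.
    by apply: contraT => /e_min; rewrite ltnn.
  apply/forallP => l; rewrite add0n /power_sum; apply: defect_ge_sum => i.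
  rewrite /defect_ge; apply/orP; right; rewrite addn0.
  apply: leq_trans (size_scale_leq _ _) _.
  by apply: leq_trans (size_poly_exp_leq _ _) _; rewrite p_deg.
move: e_ndef; rewrite -(shift _ j) negb_forall => /existsP[l].
rewrite negb_or -ltnNge => /andP[s_neq0 lt_s] /forallP/(_ l).
rewrite /defect_ge (negbTE s_neq0) /= => le_s.
by exists l; split => //; apply/eqP; rewrite eqn_leq le_s -ltnS -addnS.
Qed.

End PowerSums.

(** Taking as rows the degrees of the chosen polynomials makes the minor triangular,
    with their leading coefficients on the diagonal. *)
Lemma minor_of_increasing_sizes (K : fieldType) (N r d : nat)
    (q : 'I_r -> {poly K}) (J : 'I_d -> 'I_r) :
  (forall j, size (q j) <= N)%N ->
  (forall b, q (J b) != 0) ->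
  (forall b b' : 'I_d, b < b' -> size (q (J b)) < size (q (J b')))%N ->
  exists I : 'I_d -> 'I_N,
    \det (mxsub I J (\matrix_(i, j) (q j)`_i)) != 0.
Proof.
move=> sz_q qJ_neq0 sz_incr.
have ltN b : ((size (q (J b))).-1 < N)%N.
  by apply: leq_trans (sz_q (J b)); rewrite prednK ?size_poly_gt0.
exists (fun b => Ordinal (ltN b)); rewrite -det_tr det_trig.
  by apply/prodf_neq0 => b _; rewrite !mxE /= -lead_coefE lead_coef_eq0.
apply/is_trig_mxP => b b' lt_b; rewrite !mxE /= nth_default //.
by rewrite -ltnS prednK ?size_poly_gt0 // sz_incr.
Qed.

(** * The linear system satisfied by the coefficients of a dependence *)

(** The matrix of [s |-> \sum_l a_l s(p_l)] on origin-passing polynomials [s] of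
    degree at most [r]; column [j] is the image of ['X^(j.+1)]. *)
Definition power_sum_mx (R : comNzRingType) (k m r : nat)
    (a : 'I_k -> R) (p : 'I_k -> {poly R}) : 'M[R]_((m * r).+1, r) :=
  \matrix_(i, j) (\sum_l a l *: p l ^+ j.+1)`_i.

(** Cut the exponents [1, ..., d * k] into [d] blocks of length [k] and choose in
    block [b] the exponent [b * k + 1 + l b] whose power sum attains the common
    defect [e]: its degree [m * (b * k + 1 + l b) - e] increases with [b]. *)
Lemma power_sum_mx_minor (K : fieldType) (k m r d : nat)
    (a : 'I_k -> K) (p : 'I_k -> {poly K}) :
  (0 < m)%N -> (d * k <= r)%N -> injective p -> (forall i, size (p i) = m.+1) ->
  (exists i, a i != 0) ->
  exists (I : 'I_d -> 'I_(m * r).+1) (J : 'I_d -> 'I_r),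
    \det (mxsub I J (power_sum_mx m r a p)) != 0.
Proof.
move=> m_gt0 le_r p_inj p_deg a_neq0.
have [e eP] := power_sum_size_in_block p_inj p_deg a_neq0.
have /fin_all_exists[l lP] (b : 'I_d) := eP (b * k).+1.
have Jlt (b : 'I_d) : (b * k + l b < r)%N.
  apply: leq_trans le_r; apply: (@leq_trans (b.+1 * k)).
    by rewrite mulSn addnC ltn_add2r.
  by rewrite leq_mul2r ltn_ord orbT.
pose J b := Ordinal (Jlt b).
have [||b b' lt_b|I detI] := @minor_of_increasing_sizes K (m * r).+1 r d
  (fun j => power_sum a p j.+1) J; last by exists I, J.
- move=> j; rewrite /power_sum; apply: leq_trans (size_sum _ _ _) _.
  apply/bigmax_leqP => i _; apply: leq_trans (size_scale_leq _ _) _.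
  apply: leq_trans (size_poly_exp_leq _ _) _; rewrite p_deg /= ltnS leq_mul2l.
  by rewrite ltn_ord orbT.
- by move=> b; have [] := lP b.
have [_] := lP b; have [_] := lP b'; rewrite /= !addSn => eqb' eqb.
rewrite -(ltn_add2r e) eqb eqb' ltnS ltn_mul2l m_gt0 /= ltnS.
have : (b.+1 * k <= b' * k)%N by rewrite leq_mul2r lt_b orbT.
have := ltn_ord (l b); rewrite mulSn; lia.
Qed.

Lemma comp_poly_row (K : fieldType) (r : nat) (s p : {poly K}) :
  origin_passing_le r s -> s \Po p = \sum_(j < r) s`_j.+1 *: p ^+ j.+1.
Proof.
case=> sz_s s0; rewrite comp_polyE.
have -> : \sum_(i < size s) s`_i *: p ^+ i = \sum_(i < r.+1) s`_i *: p ^+ i.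
  rewrite (big_ord_widen _ (fun i => s`_i *: p ^+ i) sz_s) big_mkcond /=.
  by apply: eq_bigr => i _; case: ltnP => // le_i; rewrite nth_default // scale0r.
by rewrite big_ord_recl -horner_coef0 s0 scale0r add0r.
Qed.

(** * Generic scalars and polynomials *)

Section Generic.
Variables (K : fieldType) (k m : nat) (i0 : 'I_k).

(** The unknowns of a dependence normalized by [a i0 = 1]: the other scalars, and
    the coefficient of ['X^(l.+1)] in the [i]-th polynomial for each [(i, l)]. *)
Definition param := ({i : 'I_k | i != i0} + 'I_k * 'I_m)%type.

Let n := #|{: param}|.

Lemma card_param : n = (k.-1 + k * m)%N.
Proof.
rewrite /n card_sum card_prod !card_ord card_sig; congr (_ + _)%N.
by rewrite -[in RHS](card_ord k) -(cardC1 i0).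
Qed.

Definition generic_scalar (i : 'I_k) : {mpoly K[n]} :=
  if insub i is Some j then 'X_(enum_rank (inl j : param)) else 1.

Definition generic_poly (i : 'I_k) : {poly {mpoly K[n]}} :=
  \sum_(l < m) 'X_(enum_rank (inr (i, l) : param)) *: 'X^(l.+1).

Lemma generic_power_sum_mx (r : nat) (a : 'I_k -> K) (p : 'I_k -> {poly K}) :
  a i0 = 1 -> (forall i, origin_passing_le m (p i)) ->
  exists y : 'I_n -> K,
    map_mx (meval y) (power_sum_mx m r generic_scalar generic_poly)
      = power_sum_mx m r a p.
Proof.
move=> a1 p_le.
pose y (t : 'I_n) : K :=
  match enum_val t : param with inl j => a (val j) | inr (i, l) => (p i)`_l.+1 end.
have ev_a i : (generic_scalar i).@[y] = a i.
  rewrite /generic_scalar; case: insubP => [j _ <-|].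
    by rewrite mevalXU /y enum_rankK.
  by rewrite negbK meval1 => /eqP ->.
have ev_p i : map_poly (meval y) (generic_poly i) = p i.
  rewrite /generic_poly rmorph_sum /= -[RHS](row_of_polyK (p_le i)) /poly_of_row.
  apply: eq_bigr => l _; rewrite map_polyZ map_polyXn /= mevalXU /y enum_rankK.
  by rewrite mxE.
exists y; apply/matrixP => i j; rewrite !mxE -coef_map rmorph_sum /=; congr _`_i.
by under eq_bigr do rewrite map_polyZ rmorphXn /= ev_a ev_p.
Qed.

(** The dimension count: [(k - 1) + k * m] parameters against a system of rank at
    least [d = k * (m + 1)]. *)
Lemma dependence_in_hypersurface (r : nat) :
  (k ^ 2 * (m + 1) <= r)%N -> (0 < m)%N ->
  exists2 f : {mpoly K[r]}, f != 0
    & forall (s : {poly K}) (a : 'I_k -> K) (p : 'I_k -> {poly K}),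
        origin_passing_le r s -> injective p ->
        (forall i, origin_passing (p i) /\ has_degree m (p i)) ->
        a i0 != 0 -> \sum_i a i *: (s \Po p i) = 0 ->
        f.@[row_of_poly r s ord0] = 0.
Proof.
move=> le_r m_gt0; pose d := (k * (m + 1))%N.
have lt_nd : (n < d)%N.
  by rewrite card_param /d; have := ltn_ord i0; rewrite mulnDr muln1; lia.
have [f f_neq0 fP] := kernels_in_hypersurface
  (power_sum_mx m r generic_scalar generic_poly) lt_nd.
exists f => // s a p s_le p_inj p_deg ai0_neq0 dep.
pose b i := a i / a i0.
have b_neq0 : exists i, b i != 0 by exists i0; rewrite /b divff ?oner_neq0.
have p_size i : size (p i) = m.+1 by have [] := p_deg i.
have p_le i : origin_passing_le m (p i).
  by split; [rewrite p_size | have [] := p_deg i].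
have [y yE] := @generic_power_sum_mx r b p (divff ai0_neq0) p_le.
have [|I [J det_neq0]] := @power_sum_mx_minor K k m r d b p m_gt0 _ p_inj p_size b_neq0.
  by apply: leq_trans le_r; rewrite /d -mulnA (mulnC (m + 1)%N) mulnA mulnn.
rewrite (@meval_eq _ _ _ (fun j => (\col_j s`_j.+1 : 'cV_r) j 0)) => [|j];
  last by rewrite !mxE.
apply: (fP y _ I J); rewrite yE //.
apply/colP => i; rewrite !mxE.
rewrite -[RHS](coef0 _ i).
have <- : (a i0)^-1 *: \sum_i a i *: (s \Po p i) = 0 by rewrite dep scaler0.
rewrite scaler_sumr coef_sum.
under [RHS]eq_bigr => l _ do
  rewrite scalerA mulrC (comp_poly_row _ s_le) scaler_sumr coef_sum.
rewrite exchange_big /=; apply: eq_bigr => j _; rewrite !mxE coef_sum mulr_suml.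
by apply: eq_bigr => l _; rewrite !coefZ mulrAC mulrA.
Qed.

End Generic.

(** * The theorem *)

Theorem theorem3p4 (K : fieldType) (charK0 : [pchar K] =i pred0)
    (m k r : nat) (m_ge1 : (1 <= m)%N) (k_ge1 : (1 <= k)%N)
    (r_ge : (k ^ 2 * (m + 1) <= r)%N) :
  exists U : {poly K} -> Prop,
    [/\ zariski_open_polys r U,
        exists s : {poly K}, U s
      & forall s : {poly K}, U s ->
        forall p : 'I_k -> {poly K},
          injective p ->
          (forall i, origin_passing (p i) /\ has_degree m (p i)) ->
          lin_indep (fun i => s \Po p i)].
Proof.
have /fin_all_exists2[f f_neq0 fP] (i0 : 'I_k) :=
  @dependence_in_hypersurface K k m i0 r r_ge m_ge1.
pose g := \prod_i0 f i0.
exists (fun s => origin_passing_le r s /\ g.@[row_of_poly r s ord0] != 0); split.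
- split=> [s []//|]; exists (fun h => h = g) => c; rewrite poly_of_rowK.
  split=> [nU h ->|/(_ g erefl) -> [_]]; last by rewrite eqxx.
  by apply/eqP/negPn/negP => gc; apply: nU; split=> //; apply: poly_of_rowP.
- have g_neq0 : g != 0 by apply/prodf_neq0.
  have [v gv] := meval_neq0_exists charK0 g_neq0.
  exists (poly_of_row (\row_j v j)); split; first exact: poly_of_rowP.
  by rewrite poly_of_rowK (@meval_eq _ _ _ v) // => j; rewrite mxE.
move=> s [s_le gs] p p_inj p_deg a dep i; apply/eqP/negPn/negP => ai_neq0.
case/negP: gs; rewrite /g (bigD1 i) //= mevalM.
by rewrite (fP i s a p) ?mul0r.
Qed.
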